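(* Let $n\ge 1$ and let $A=(a_{ij})_{1\le i,j\le n}$ be the general $n\times n$ matrix, whose entries $a_{ij}$ are $n^2$ independent commuting indeterminates. Let $S\subseteq\{(i,j)\mid 1\le i,j\le n\}$ be any subset of cardinality $n+1$. Then there exist polynomials $q_s\in\mathbb{Q}[a_{ij}: 1\le i,j\le n]$, $s\in S$, not all zero and independent of $m$, such that $$\sum_{s\in S} q_s\cdot (A^m)_s=0$$ for all integers $m>1$.
   Context: For a matrix $B$ and a position $s=(i,j)$, $B_s=B_{ij}$ denotes the $(i,j)$ entry of $B$. The polynomials $q_s$ may depend on $n$ and $S$ but not on the exponent $m$. *)

(* Defs.v *)
From mathcomp Require Import all_boot all_order all_algebra.
From mathcomp Require Import mpoly.

Set Implicit Arguments.
Unset Strict Implicit.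
Unset Printing Implicit Defensive.

Import GRing.Theory.
Local Open Scope ring_scope.

(* The n * n variables of {mpoly rat[n * n]} are the indeterminates a_ij,
   numbered by mxvec_index, a bijection between 'I_n * 'I_n and 'I_(n * n). *)
Definition generic_mx (n : nat) : 'M[{mpoly rat[n * n]}]_n :=
  \matrix_(i, j) 'X_(mxvec_index i j).

(* Main.v *)
Require Import Defs.
From mathcomp Require Import all_boot all_order all_algebra.
From mathcomp Require Import mpoly.

Set Implicit Arguments.
Unset Strict Implicit.
Unset Printing Implicit Defensive.

Import GRing.Theory.
Local Open Scope ring_scope.

(** By Cayley-Hamilton every power of [A] is a linear combination, over the
    ring of entries, of the [n] powers [A ^+ i], [i < n].  A relation between
    the entries at the positions in [S] therefore holds for all powers as soon
    as it holds for these [n], i.e. as soon as its [n + 1] coefficients solve a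
    homogeneous linear system of [n] equations. *)

(** Padding [M] with zero columns to a square matrix makes its determinant vanish; over a domain
    this gives a nonzero left kernel vector, which also kills the block [M]. *)
Lemma underdetermined_mulmx0 (R : idomainType) (m n : nat) (M : 'M[R]_(m, n)) :
  (n < m)%N -> exists2 v : 'rV_m, v != 0 & v *m M = 0.
Proof.
move=> lt_nm; have [k def_m] : {k | m = (n + k.+1)%N}.
  by exists (m - n).-1; rewrite prednK ?subn_gt0 // subnKC // ltnW.
subst m; have /det0P[v v0] : \det (row_mx M (0 : 'M_(_, k.+1))) == 0.
  rewrite (expand_det_col _ (rshift n ord0)) big1 // => i _.
  by rewrite row_mxEr mxE mul0r.
rewrite mul_mx_row => /(congr1 lsubmx); rewrite row_mxKl linear0 => vM0.
by exists v.
Qed.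

(** The [c i] are the coefficients of the remainder of ['X^m] modulo the characteristic polynomial,
    which is monic, so division works over any commutative ring. *)
Lemma exp_mx_span (R : comNzRingType) (n : nat) (A : 'M[R]_n.+1) (m : nat) :
  exists c : 'I_n.+1 -> R, A ^+ m = \sum_(i < n.+1) c i *: A ^+ i.
Proof.
set p := char_poly A; have p_monic : p \is monic := char_poly_monic A.
set r := Pdiv.Ring.rmodp 'X^m p; exists (fun i => r`_i).
have sz_r : (size r <= n.+1)%N.
  by rewrite -ltnS -(size_char_poly A) Pdiv.Ring.ltn_rmodp monic_neq0.
rewrite -[in LHS](horner_mx_X A) -rmorphXn (Pdiv.RingMonic.rdivp_eq p_monic 'X^m).
rewrite rmorphD rmorphM /= Cayley_Hamilton mulr0 add0r -/r.
rewrite -[in LHS](take_poly_id sz_r) /take_poly poly_def rmorph_sum.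
apply: eq_bigr => i _.
by rewrite /= horner_mxZ rmorphXn /= horner_mx_X.
Qed.

Lemma exp_mx_entries_dependent (R : idomainType) (n : nat) (A : 'M[R]_n.+1)
    (S : {set 'I_n.+1 * 'I_n.+1}) : (n.+1 < #|S|)%N ->
  exists q : 'I_n.+1 * 'I_n.+1 -> R, (exists2 s, s \in S & q s != 0) /\
    forall m, \sum_(s in S) q s * (A ^+ m) s.1 s.2 = 0.
Proof.
move=> ltS.
pose M := \matrix_(k < #|S|, i < n.+1)
  (A ^+ i) (enum_val k).1 (enum_val k).2.
have [v /rV0Pn[k vk0] vM0] := underdetermined_mulmx0 M ltS.
have kS := enum_valP k.
(* [kS] certifies that [S] is nonempty, as [enum_rank_in] requires; outside [S] the value of [q] is
   junk that no sum sees. *)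
pose q s := v 0 (enum_rank_in kS s).
exists q; split; first by exists (enum_val k); rewrite // /q enum_valK_in.
have q_low (i : 'I_n.+1) : \sum_(s in S) q s * (A ^+ i) s.1 s.2 = 0.
  rewrite big_enum_val; have /matrixP/(_ 0 i) := vM0; rewrite !mxE; apply: etrans.
  by apply: eq_bigr => j _; rewrite /q enum_valK_in mxE.
move=> m; have [c ->] := exp_mx_span A m.
under eq_bigr => s _.
  rewrite summxE mulr_sumr.
  under eq_bigr => i _ do rewrite mxE mulrCA.
  over.
rewrite exchange_big big1 //= => i _.
by rewrite -mulr_sumr q_low mulr0.
Qed.

Theorem mainTheorem1 (n : nat) (n_gt0 : (1 <= n)%N)
    (S : {set 'I_n * 'I_n}) (cardS : #|S| = n.+1) :
  exists q : 'I_n * 'I_n -> {mpoly rat[n * n]},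
    (exists2 s, s \in S & q s != 0) /\
    forall m : nat, (1 < m)%N ->
      \sum_(s in S) q s * (generic_mx n ^+ m) s.1 s.2 = 0.
Proof.
case: n n_gt0 S cardS => // n _ S cardS.
have ltS : (n.+1 < #|S|)%N by rewrite cardS.
have [q [q_neq0 qA]] := exp_mx_entries_dependent (generic_mx n.+1) ltS.
by exists q; split=> // m _; apply: qA.
Qed.
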